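(* For each real $q\in(1,2)$ there exist ordered matchings $\mathcal M_n$ on $n$ vertices (one for each even positive integer $n$) such that $$R(\mathcal M_n)=n^{q+o(1)}\qquad\text{as } n\to\infty .$$
   Context: An ordered graph is a finite simple graph with a linear ordering of its vertices. An ordered matching on $n$ vertices ($n$ even) is an ordered graph on $n$ vertices in which every vertex has degree exactly 1. An ordered graph $\mathcal H$ is contained in (has a copy in) $\mathcal G$ if there is an order-preserving injection from the vertices of $\mathcal H$ to the vertices of $\mathcal G$ that maps edges to edges. $R(\mathcal G)$ is the minimum $N$ such that every 2-coloring of the edges of the complete ordered graph on $N$ vertices contains a monochromatic copy of $\mathcal G$. *)

(* Defs.v *)
From mathcomp Require Import all_boot.

Set Implicit Arguments.
Unset Strict Implicit.
Unset Printing Implicit Defensive.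

(* The vertices of an ordered graph on n vertices are the elements of 'I_n with
   their usual order: every n-element linear order is uniquely isomorphic to
   it. *)
Record ordered_graph (n : nat) := OrderedGraph {
  edge : rel 'I_n;
  edge_sym : symmetric edge;
  edge_irr : irreflexive edge
}.

Definition is_ordered_matching n (G : ordered_graph n) : bool :=
  ~~ odd n && [forall i, #|[set j | edge G i j]| == 1].

Definition contained_in n N (H : ordered_graph n) (G : ordered_graph N) : bool :=
  [exists f : {ffun 'I_n -> 'I_N},
    [&& injectiveb f,
        [forall i : 'I_n, forall j : 'I_n, (i <= j) ==> (f i <= f j)]
      & [forall i, forall j, edge H i j ==> edge G (f i) (f j)]]].

Definition color_edge N (c : {ffun {set 'I_N} -> bool}) (b : bool) : rel 'I_N :=
  [rel i j | (i != j) && (c [set i; j] == b)].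

Lemma color_edge_sym N (c : {ffun {set 'I_N} -> bool}) (b : bool) :
  symmetric (color_edge c b).
Proof. by move=> i j; rewrite /color_edge /= eq_sym setUC. Qed.

Lemma color_edge_irr N (c : {ffun {set 'I_N} -> bool}) (b : bool) :
  irreflexive (color_edge c b).
Proof. by move=> i; rewrite /color_edge /= eqxx. Qed.

(* A colouring assigns a value to every vertex set, but only its values on
   two-element sets, i.e. on the edges of the complete graph, are ever used. *)
Definition color_class N (c : {ffun {set 'I_N} -> bool}) (b : bool) :
    ordered_graph N :=
  OrderedGraph (@color_edge_sym N c b) (@color_edge_irr N c b).

Definition arrows n (G : ordered_graph n) (N : nat) : bool :=
  [forall c : {ffun {set 'I_N} -> bool},
    [exists b : bool, contained_in G (color_class c b)]].

Lemma ramsey_seq (s t : nat) : exists N, forall (T : eqType) (c : rel T)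
    (l : seq T), N <= size l ->
  exists2 l', subseq l' l &
    (size l' = s /\ pairwise c l')
    \/ (size l' = t /\ pairwise (fun x y => ~~ c x y) l').
Proof.
elim: s t => [|s IHs] t.
  by exists 0 => T c l _; exists [::]; [exact: sub0seq | left].
elim: t => [|t [N2 IHt]].
  by exists 0 => T c l _; exists [::]; [exact: sub0seq | right].
have [N1 {}IHs] := IHs t.+1.
exists (N1 + N2).+1 => T c [//|x l]; rewrite /= ltnS => lN.
have sub (a : pred T) l' : subseq l' (filter a l) ->
    subseq (x :: l') (x :: l) /\ all a l'.
  move=> sl; split; first by rewrite /= eqxx (subseq_trans sl) ?filter_subseq.
  by apply/allP => y /(mem_subseq sl); rewrite mem_filter => /andP[].
have tailS (a : pred T) l' : subseq l' (filter a l) -> subseq l' (x :: l).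
  move=> sl; apply: subseq_trans (subseq_cons l x).
  exact: subseq_trans sl (filter_subseq _ _).
have [le1|lt1] := leqP N1 (size (filter (c x) l)).
  have [l' sl [[sz pw]|H]] := IHs T c _ le1; last first.
    by exists l'; [exact: tailS sl | right].
  have [sxl al] := sub _ _ sl.
  by exists (x :: l') => //; left; rewrite /= sz al pw.
have le2 : N2 <= size (filter (fun y => ~~ c x y) l).
  have E : size (filter (c x) l) + size (filter (fun y => ~~ c x y) l) = size l.
    by rewrite !size_filter -(count_predC (c x) l).
  by rewrite -(leq_add2l N1) (leq_trans lN) // -E leq_add2r ltnW.
have [l' sl [H|[sz pw]]] := IHt T c _ le2.
  by exists l'; [exact: tailS sl | left].
have [sxl al] := sub _ _ sl.
by exists (x :: l') => //; right; rewrite /= sz al pw.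
Qed.

Lemma arrows_exists n (G : ordered_graph n) : exists N, arrows G N.
Proof.
have [N HN] := ramsey_seq n n; exists N; apply/forallP => c.
have := HN _ (fun i j : 'I_N => c [set i; j]) (enum 'I_N).
rewrite size_enum_ord leqnn => /(_ isT) [l sl Hl].
have [b [sz pw]] : exists b,
    size l = n /\ pairwise (fun i j : 'I_N => c [set i; j] == b) l.
  case: Hl => -[sz pw]; [exists true | exists false]; split=> //;
    by apply: sub_pairwise pw => i j; case: (c _).
have lt_pw : pairwise (fun i j : 'I_N => i < j) l.
  apply: subseq_pairwise sl _.
  by rewrite -(pairwise_map val ltn) val_enum_ord -sorted_pairwise
    ?iota_ltn_sorted //; exact: ltn_trans.
have szt : size l == n by apply/eqP.
pose f := [ffun i : 'I_n => tnth (Tuple szt) i].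
have nthf x0 (i : 'I_n) : f i = nth x0 l i by rewrite ffunE (tnth_nth x0).
have fP (r : rel 'I_N) (i j : 'I_n) : pairwise r l -> i < j -> r (f i) (f j).
  have [x0 _] : exists x0, x0 = f i by exists (f i).
  move=> rl ij; rewrite !(nthf x0).
  by apply: (pairwiseP x0 rl); rewrite ?inE ?sz.
have flt (i j : 'I_n) : i < j -> f i < f j.
  exact: (fP (fun u v : 'I_N => u < v)).
have finj : injective f.
  move=> i j fij; case: (ltngtP i j) => [/flt|/flt|/val_inj//];
    by rewrite fij ltnn.
apply/existsP; exists b; apply/existsP; exists f; apply/and3P; split.
- exact/injectiveP.
- apply/forallP => i; apply/forallP => j; apply/implyP.
  rewrite leq_eqVlt => /orP[/eqP/val_inj->//|/flt/ltnW//].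
apply/forallP => i; apply/forallP => j; apply/implyP => eij.
have nij : i != j by apply: contraTneq eij => ->; rewrite edge_irr.
rewrite /= /color_edge /= (inj_eq finj) nij /=.
case: (ltngtP i j) => [ij|ji|/val_inj/eqP]; last by rewrite (negPf nij).
- exact: (fP (fun u v => c [set u; v] == b)).
- by rewrite setUC; exact: (fP (fun u v => c [set u; v] == b)).
Qed.

Definition ordered_ramsey n (G : ordered_graph n) : nat :=
  ex_minn (arrows_exists G).

(* Main.v *)
Require Import Defs.
From mathcomp Require Import all_boot all_order all_algebra.
From mathcomp Require Import all_classical all_reals all_analysis.
From mathcomp Require Import zify lra.
Import Order.TTheory GRing.Theory Num.Theory.
Import numFieldNormedType.Exports.
Local Open Scope classical_set_scope.
Local Open Scope ring_scope.

(** The matching is a nested matching of [k] edges [i -- 2k - 1 - i], followed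
    by [t] edges joining consecutive vertices, with [2k + 2t = n]. Its ordered
    Ramsey number is of order [k * t], so [k] of order [n^(q-1)], for which [t]
    is of order [n], gives [n^q] up to a constant factor. Each part by itself
    has a linear Ramsey number; the product comes from their interaction.

    Lower bound ([lt_ordered_ramsey_matching]). Cut [t * (2k - 1)] vertices into
    [t] intervals of length [2k - 1] and let the colour of a pair say whether its
    ends are in one interval. A nested matching coloured inside has all its [2k]
    vertices in the interval of its outermost edge, which is too short. In a
    consecutive matching coloured across, every edge moves on to a later interval,
    so [t] edges would need [t + 1] intervals.

    Upper bound ([ordered_ramsey_matching_le]). Take a first segment of [4k]
    vertices, then [t] intervals of length [2k], then a last segment of [4t]
    vertices. The last segment has a consecutive matching of some colour [b],
    and the first has a nested matching of some colour. If that colour is [b],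
    they form a copy. Otherwise it is the opposite colour [~~ b]. If each of the
    [t] intervals has an edge of colour [~~ b], these edges continue the nested
    matching to a copy. If not, an interval is a clique of colour [b] on [2k]
    vertices, and it has a nested matching of colour [b] to put in front of the
    last segment.

    A constant factor costs [O(1 / ln n)] in the exponent
    ([powR_asymptotics]). *)

(** * The matchings *)

Section OrderedMatchings.
Local Open Scope nat_scope.
Set Implicit Arguments.
Unset Strict Implicit.

(** As [2 * k] is even, pairing by parity above [2 * k] never reaches the nested
    part. *)
Definition partner k i :=
  if i < 2 * k then 2 * k - 1 - i else if odd i then i.-1 else i.+1.

Lemma partnerK k : involutive (partner k).
Proof. by rewrite /partner => i; do !case: ifP; lia. Qed.

Lemma partner_neq k i : partner k i != i.
Proof. by rewrite /partner; do !case: ifP; lia. Qed.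

Definition matching_edge k n : rel 'I_n :=
  fun i j => partner k i == j :> nat.

Lemma matching_edge_sym k n : symmetric (@matching_edge k n).
Proof. by move=> i j; apply/eqP/eqP => <-; rewrite partnerK. Qed.

Lemma matching_edge_irr k n : irreflexive (@matching_edge k n).
Proof. by move=> i; apply/negbTE/partner_neq. Qed.

Definition matching k n : ordered_graph n :=
  OrderedGraph (@matching_edge_sym k n) (@matching_edge_irr k n).

Lemma matching_is_ordered_matching k n :
  ~~ odd n -> 2 * k <= n -> is_ordered_matching (matching k n).
Proof.
move=> en kn; apply/andP; split=> //; apply/forallP => i.
have ltpn : partner k i < n.
  by move: (ltn_ord i); rewrite /partner; do !case: ifP; lia.
rewrite (_ : [set j | _]%SET = [set Ordinal ltpn]%SET) ?cards1 //.
by apply/setP => j; rewrite !inE eq_sym.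
Qed.

(** * The lower bound *)

Lemma lt_ordered_ramsey_matching k t n : 0 < k -> 2 * k + 2 * t <= n ->
  t * (2 * k - 1) < ordered_ramsey (matching k n).
Proof.
move=> k0 len; rewrite /ordered_ramsey; case: ex_minnP => N arrN _.
rewrite ltnNge; apply/negP => leN; set s := 2 * k - 1 in leN.
have s0 : 0 < s by rewrite /s; lia.
pose c : {ffun {set 'I_N} -> bool} :=
  [ffun S : {set 'I_N} => [forall i in S, forall j in S, i %/ s == j %/ s]].
have cE (i j : 'I_N) : c [set i; j]%SET = (i %/ s == j %/ s).
  rewrite ffunE; apply/idP/idP => [/forall_inP/(_ i)|/eqP ij].
    rewrite !inE eqxx => /(_ isT)/forall_inP/(_ j).
    by rewrite !inE eqxx orbT; apply.
  apply/forall_inP => u /set2P Hu; apply/forall_inP => v /set2P Hv.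
  by case: Hu => ->; case: Hv => ->; rewrite ?ij ?eqxx.
move: arrN => /forallP/(_ c)/existsP[b /existsP[f]].
move=> /and3P[/injectiveP finj /forallP fle /forallP fedge].
have flt (i j : 'I_n) : i < j -> f i < f j.
  move=> ij; rewrite ltn_neqAle (implyP (forallP (fle i) j) (ltnW ij)) andbT.
  by apply: contraTneq ij => /val_inj/finj ->; rewrite ltnn.
have fcol (i j : 'I_n) : partner k i = j -> (f i %/ s == f j %/ s) = b.
  move=> ij; have := implyP (forallP (fedge i) j).
  by rewrite -cE /= /matching_edge ij eqxx => /(_ isT)/andP[_ /eqP].
case: b fcol {fedge} => fcol.
  (* The ends of the outermost nested edge are at distance at least [s]. *)
  have n0 : 0 < n by lia.
  have lt2k : 2 * k - 1 < n by lia.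
  have stretch i (lti : i < n) : f (Ordinal n0) + i <= f (Ordinal lti).
    elim: i lti => [|i IH] lti; first by rewrite addn0 (bool_irrelevance n0 lti).
    have lti' : i < n by exact: ltnW.
    by rewrite addnS (leq_ltn_trans (IH lti')) // flt /=.
  have := stretch _ lt2k; have := fcol (Ordinal n0) (Ordinal lt2k).
  rewrite /partner /= muln_gt0 k0 subn0 => /(_ erefl)/eqP E.
  by rewrite -/s => /(leq_div2r s); rewrite divnDr ?dvdnn // divnn s0 addn1
    E ltnn.
(* Consecutive edges change block, so the right end of edge [j] of this part is
   past block [j]. *)
have step j (lt0 : 2 * k + 2 * j < n) (lt1 : 2 * k + 2 * j + 1 < n) :
    f (Ordinal lt0) %/ s < f (Ordinal lt1) %/ s.
  rewrite ltn_neqAle leq_div2r ?andbT; last by apply/ltnW/flt => /=; lia.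
  by rewrite fcol // /partner /=; do !case: ifP; lia.
have climb j (ltj : 2 * k + 2 * j + 1 < n) : j < f (Ordinal ltj) %/ s.
  elim: j ltj => [|j IH] ltj.
    have lt0 : 2 * k + 2 * 0 < n by lia.
    exact: leq_trans (step _ lt0 ltj).
  have ltj' : 2 * k + 2 * j + 1 < n by lia.
  have lt0 : 2 * k + 2 * j.+1 < n by lia.
  apply: leq_ltn_trans (step _ lt0 ltj); apply: leq_trans (IH ltj') _.
  by apply/leq_div2r/ltnW/flt => /=; lia.
(* For [t = 0] the bound says that a nonempty graph does not embed in the empty
   one. *)
case: t len leN => [|t] len leN.
  have n0 : 0 < n by lia.
  by case: (f (Ordinal n0)) => x /=; rewrite ltnNge (leq_trans leN).
have ltt : 2 * k + 2 * t + 1 < n by lia.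
have := climb _ ltt; rewrite ltnNge -ltnS ltn_divLR //.
by rewrite (leq_trans (ltn_ord _) leN).
Qed.

(** * Copies inside intervals of vertices *)

(** Embeddings are functions on [nat], constrained only below [m], so that
    vertices can be prepended without changing dependent types. The pattern
    [E] and the colouring [C] are read on increasing pairs only. *)
Definition mono_copy m (E C : rel nat) (b : bool) lo hi :=
  exists g : nat -> nat,
    [/\ forall i j, i < j < m -> g i < g j,
        forall i, i < m -> lo <= g i < hi
      & forall i j, i < j < m -> E i j -> C (g i) (g j) = b].

Definition nested k : rel nat := fun i j => i + j == 2 * k - 1.
Definition consecutive : rel nat := fun i j => ~~ odd i && (j == i.+1).

Lemma mono_copy_widen m E C b lo hi lo' hi' :
  lo' <= lo -> hi <= hi' ->
  mono_copy m E C b lo hi -> mono_copy m E C b lo' hi'.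
Proof.
by move=> le1 le2 [g [g1 g2 g3]]; exists g; split=> // i /g2; lia.
Qed.

Lemma mono_copy0 E C b lo hi : mono_copy 0 E C b lo hi.
Proof. by exists id; split=> [i j|i|i j]; lia. Qed.

Lemma nested_wrap k (C : rel nat) b lo hi x y :
  lo <= x < y -> y < hi -> C x y = b ->
  mono_copy (2 * k) (nested k) C b x.+1 y ->
  mono_copy (2 * k.+1) (nested k.+1) C b lo hi.
Proof.
move=> xy yhi Cxy [g [g1 g2 g3]].
exists (fun i => if i == 0 then x else if i == (2 * k).+1 then y else g i.-1).
have g2' i : 0 < i < (2 * k).+1 -> x < g i.-1 < y by move=> ?; apply: g2; lia.
split=> [i j ij|i im|i j ij].
- have := @g1 i.-1 j.-1; have := g2' i; have := g2' j.
  by do !case: ifP; lia.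
- by have := g2' i; do !case: ifP; lia.
rewrite /nested => E.
case: eqP => i0; first by rewrite (_ : j = (2 * k).+1) ?eqxx //=; lia.
rewrite !ifF; try lia.
by apply: g3; rewrite /nested; lia.
Qed.

Lemma consecutive_cons t (C : rel nat) b lo mid hi x y :
  lo <= x < y -> y < mid <= hi -> C x y = b ->
  mono_copy (2 * t) consecutive C b mid hi ->
  mono_copy (2 * t.+1) consecutive C b lo hi.
Proof.
move=> xy ymid Cxy [g [g1 g2 g3]].
exists (fun i => if i == 0 then x else if i == 1 then y else g i.-2).
have g2' i : 1 < i < 2 * t.+1 -> mid <= g i.-2 < hi by move=> ?; apply: g2; lia.
split=> [i j ij|i im|i j ij].
- have := @g1 i.-2 j.-2; have := g2' i; have := g2' j.
  by do !case: ifP; lia.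
- by have := g2' i; do !case: ifP; lia.
rewrite /consecutive => E.
case: eqP => i0; first by rewrite (_ : j = 1) ?eqxx //=; lia.
rewrite !ifF; try lia.
by apply: g3; rewrite /consecutive; lia.
Qed.

(** The outermost pair of the window always extends one of the two matchings
    sought, which leaves a window shorter by two: hence a linear bound. *)
Lemma nested_pigeonhole (C : rel nat) b p r lo :
  mono_copy (2 * p) (nested p) C b lo (lo + 2 * (p + r)) \/
  mono_copy (2 * r) (nested r) C (~~ b) lo (lo + 2 * (p + r)).
Proof.
elim: p r lo => [|p IHp] r lo; first by left; exact: mono_copy0.
elim: r lo => [|r IHr] lo; first by right; exact: mono_copy0.
set hi := lo + _; set y := hi.-1.
have lo_y : lo <= lo < y by rewrite /y /hi; lia.
have y_hi : y < hi by rewrite /y /hi; lia.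
have [Cb|Cb] := eqVneq (C lo y) b.
  have [H|H] := IHp r.+1 lo.+1.
    left; apply: (nested_wrap lo_y y_hi Cb).
    by apply: mono_copy_widen H; rewrite /y /hi; lia.
  by right; apply: mono_copy_widen H; rewrite /hi; lia.
have [H|H] := IHr lo.+1.
  by left; apply: mono_copy_widen H; rewrite /hi; lia.
have {}Cb : C lo y = ~~ b by move: Cb; case: (C lo y); case: (b).
right; apply: (nested_wrap lo_y y_hi Cb).
by apply: mono_copy_widen H; rewrite /y /hi; lia.
Qed.

(** Same induction as for nested matchings, removing the first two vertices of
    the window. *)
Lemma consecutive_pigeonhole (C : rel nat) b p r lo :
  mono_copy (2 * p) consecutive C b lo (lo + 2 * (p + r)) \/
  mono_copy (2 * r) consecutive C (~~ b) lo (lo + 2 * (p + r)).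
Proof.
elim: p r lo => [|p IHp] r lo; first by left; exact: mono_copy0.
elim: r lo => [|r IHr] lo; first by right; exact: mono_copy0.
set hi := lo + _.
have pair_lo : lo <= lo < lo.+1 by lia.
have pair_hi : lo.+1 < lo.+2 <= hi by rewrite /hi; lia.
have [Cb|Cb] := eqVneq (C lo lo.+1) b.
  have [H|H] := IHp r.+1 lo.+2.
    left; apply: (consecutive_cons pair_lo pair_hi Cb).
    by apply: mono_copy_widen H; rewrite /hi; lia.
  by right; apply: mono_copy_widen H; rewrite /hi; lia.
have [H|H] := IHr lo.+2.
  by left; apply: mono_copy_widen H; rewrite /hi; lia.
have {}Cb : C lo lo.+1 = ~~ b by move: Cb; case: (C lo lo.+1); case: (b).
right; apply: (consecutive_cons pair_lo pair_hi Cb).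
by apply: mono_copy_widen H; rewrite /hi; lia.
Qed.

(** This is where [t * L] vertices are needed: one edge from each of [t] intervals
    of length [L], unless one interval has no edge of colour [b]. *)
Lemma consecutive_or_clique (C : rel nat) b L t lo :
  mono_copy (2 * t) consecutive C b lo (lo + t * L) \/
  exists x, [/\ lo <= x, x + L <= lo + t * L
    & forall i j, i < j < L -> C (x + i) (x + j) = ~~ b].
Proof.
elim: t lo => [|t IH] lo; first by left; exact: mono_copy0.
have [/existsP[i /existsP[j /andP[ij /eqP Cij]]]|noedge] :=
  boolP [exists i : 'I_L, exists j : 'I_L,
           (i < j) && (C (lo + i) (lo + j) == b)].
  have [H|[x [x1 x2 x3]]] := IH (lo + L); last first.
    by right; exists x; split=> //; lia.
  left; have := ltn_ord j => ltj.
  apply: (@consecutive_cons _ _ _ _ (lo + L) _ (lo + i) (lo + j)) => //; try lia.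
  by apply: mono_copy_widen H; lia.
right; exists lo; split=> [||i j /andP[ij jL]]; try lia.
move: noedge; rewrite negb_exists => /forallP/(_ (Ordinal (ltn_trans ij jL))).
rewrite negb_exists => /forallP/(_ (Ordinal jL)) /=; rewrite ij /=.
by case: (C _ _); case: (b).
Qed.

Lemma nested_then_consecutive k t (C : rel nat) b lo mid hi :
  mid <= hi -> lo <= mid ->
  mono_copy (2 * k) (nested k) C b lo mid ->
  mono_copy (2 * t) consecutive C b mid hi ->
  mono_copy (2 * k + 2 * t) (fun i j => partner k i == j) C b lo hi.
Proof.
move=> midhi lomid [g [g1 g2 g3]] [h [h1 h2 h3]].
exists (fun i => if i < 2 * k then g i else h (i - 2 * k)).
have h2' i : 2 * k <= i < 2 * k + 2 * t -> mid <= h (i - 2 * k) < hi.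
  by move=> ?; apply: h2; lia.
split=> [i j ij|i im|i j ij].
- have := @g1 i j; have := g2 i; have := g2 j.
  have := @h1 (i - 2 * k) (j - 2 * k); have := h2' i; have := h2' j.
  by do !case: ifP; lia.
- by have := g2 i; have := h2' i; do !case: ifP; lia.
rewrite /partner; case: ifP => [ik /eqP ji|ik].
  by rewrite ifT; [apply: g3; rewrite /nested; lia | lia].
case: ifP => oi /eqP ji; first lia.
by rewrite ifF; [apply: h3; rewrite /consecutive; lia | lia].
Qed.

(** * The upper bound *)

Lemma ordered_ramsey_matching_le k t n : n <= 2 * k + 2 * t ->
  ordered_ramsey (matching k n) <= 4 * k + t * (2 * k) + 4 * t.
Proof.
move=> len; rewrite /ordered_ramsey; case: ex_minnP => N0 _; apply.
set N := (X in arrows _ X); apply/forallP => c.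
pose C : rel nat := fun x y =>
  if insub x is Some i then if insub y is Some j then c [set i; j : 'I_N]%SET
  else true else true.
suff [b [g [g1 g2 g3]]] : exists b,
    mono_copy (2 * k + 2 * t) (fun i j => partner k i == j) C b 0 N.
  have gN (i : 'I_n) : g i < N.
    by case/andP: (g2 i (leq_trans (ltn_ord i) len)).
  have glt (i j : 'I_n) : i < j -> g i < g j.
    by move=> ij; apply: g1; rewrite ij (leq_trans (ltn_ord j) len).
  have gC (i j : 'I_n) : i < j -> partner k i = j ->
      c [set Ordinal (gN i); Ordinal (gN j)]%SET = b.
    move=> ij pij; rewrite -(g3 i j) ?pij ?eqxx //; last first.
      by rewrite ij (leq_trans (ltn_ord j) len).
    by rewrite /C (insubT (fun x => x < N) (gN i)) (insubT (fun x => x < N) (gN j)).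
  apply/existsP; exists b; apply/existsP; exists [ffun i => Ordinal (gN i)].
  have ginj : injective [ffun i : 'I_n => Ordinal (gN i)].
    move=> i j; rewrite !ffunE => /(congr1 val) /= gij.
    by case: (ltngtP i j) => [/glt|/glt|/val_inj//]; rewrite gij ltnn.
  apply/and3P; split; first exact/injectiveP.
    apply/forallP => i; apply/forallP => j; apply/implyP; rewrite !ffunE /=.
    by rewrite leq_eqVlt => /orP[/eqP/val_inj->//|/glt/ltnW].
  apply/forallP => i; apply/forallP => j; apply/implyP => /eqP pij.
  have nij : i != j :> nat by rewrite -pij eq_sym partner_neq.
  rewrite /= /color_edge /= (inj_eq ginj) !ffunE.
  rewrite -(inj_eq val_inj) nij /=; apply/eqP.
  case: (ltngtP i j) => [ij|ji|ij]; last by rewrite ij eqxx in nij.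
    exact: gC.
  by rewrite finset.setUC; apply: gC => //; rewrite -pij partnerK.
(* [F] ends the first segment and [L] starts the last one. *)
set F := 4 * k; set L := F + t * (2 * k).
have [b last_consec] : exists b, mono_copy (2 * t) consecutive C b L N.
  have [H|H] := consecutive_pigeonhole C true t t L; [exists true|exists false];
    by apply: mono_copy_widen H; rewrite /N /L; lia.
have conclude b' mid : F <= mid <= N ->
    mono_copy (2 * k) (nested k) C b' 0 mid ->
    mono_copy (2 * t) consecutive C b' mid N -> exists b0,
    mono_copy (2 * k + 2 * t) (fun i j => partner k i == j) C b0 0 N.
  move=> midN H1 H2; exists b'.
  by apply: nested_then_consecutive H1 H2; lia.
have [first_nest|first_nest] := nested_pigeonhole C b k k 0.
  apply: (conclude b L) => //; first by rewrite /N /L; lia.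
  by apply: mono_copy_widen first_nest; rewrite /L /F; lia.
have {}first_nest : mono_copy (2 * k) (nested k) C (~~ b) 0 F.
  by apply: mono_copy_widen first_nest; rewrite /F; lia.
have [mid_consec|[x [Fx xL clique]]] :=
    consecutive_or_clique C (~~ b) (2 * k) t F.
  apply: (conclude _ F) first_nest _; first by rewrite /N /L /F; lia.
  by apply: mono_copy_widen mid_consec; rewrite /N /F; lia.
apply: (conclude b L) last_consec; first by rewrite /N /L; lia.
exists (fun i => x + i); split=> [i j|i|i j ij _]; rewrite /L; try lia.
by rewrite clique // negbK.
Qed.

End OrderedMatchings.

(** * The exponent *)

(** On the logarithmic scale the bounds say that [ln (u n)] and [q * ln n] differ
    by at most [ln C], so their quotients by [ln n] differ by [o(1)]. *)
Lemma powR_asymptotics (R : realType) (q C : R) (P : pred nat) (u : nat -> nat) :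
    0 < C -> (forall n, P n -> (1 < n)%N && (0 < u n)%N) ->
    (\forall n \near \oo,
      P n -> C^-1 * n%:R `^ q <= (u n)%:R <= C * n%:R `^ q) ->
  exists eps : nat -> R, (eps n @[n --> \oo] --> (0 : R)) /\
    forall n, P n -> (u n)%:R = n%:R `^ (q + eps n).
Proof.
move=> C0 Ppos bounds.
pose eps n : R := if P n then ln (u n)%:R / ln n%:R - q else 0.
have ln_gt0n n : P n -> 0 < ln (n%:R : R).
  by move=> /Ppos/andP[n1 _]; rewrite ln_gt0 // ltr1n.
exists eps; split; last first.
  move=> n Pn; have /andP[n1 un] := Ppos _ Pn.
  have ln0 := ln_gt0n _ Pn.
  rewrite /eps Pn addrC subrK /powR pnatr_eq0 gtn_eqF ?(ltnW n1) //.
  by rewrite divfK ?gt_eqF // lnK // posrE ltr0n.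
apply/cvgr0Pnorm_lt => e e0.
near=> n.
rewrite /eps; case: ifPn => [Pn|_]; last by rewrite normr0.
have /andP[n1 un] := Ppos _ Pn.
have ln0 := ln_gt0n _ Pn.
have n0 : 0 < (n%:R : R) by rewrite ltr0n ltnW.
have /andP[lo hi] : C^-1 * n%:R `^ q <= (u n)%:R <= C * n%:R `^ q.
  by move: Pn; near: n.
have nq0 : 0 < (n%:R : R) `^ q by exact: powR_gt0.
have u0 : 0 < ((u n)%:R : R) by rewrite ltr0n.
have Cnq0 : 0 < C * n%:R `^ q by exact: mulr_gt0.
have Vnq0 : 0 < C^-1 * n%:R `^ q by rewrite mulr_gt0 ?invr_gt0.
have lnhi : ln (u n)%:R <= ln C + q * ln n%:R.
  by rewrite -ln_powR -lnM ?posrE // ler_ln ?posrE.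
have lnlo : - ln C + q * ln n%:R <= ln (u n)%:R.
  by rewrite -lnV ?posrE // -ln_powR -lnM ?posrE ?invr_gt0 // ler_ln ?posrE.
have lnC : ln C < e * ln n%:R.
  rewrite mulrC -ltr_pdivrMr // -ltr_expR lnK ?posrE //.
  by near: n; exact: nbhs_infty_gtr.
have -> : ln (u n)%:R / ln n%:R - q = (ln (u n)%:R - q * ln n%:R) / ln n%:R.
  by rewrite mulrBl mulfK // gt_eqF.
rewrite normrM normfV (gtr0_norm ln0) ltr_pdivrMr // ltr_norml.
by apply/andP; split; lra.
Unshelve. all: by end_near. Qed.

Theorem theorem22 (R : realType) (q : R) (hq1 : 1 < q) (hq2 : q < 2) :
  exists M : forall n : nat, ordered_graph n,
    (forall n : nat, (0 < n)%N -> ~~ odd n -> is_ordered_matching (M n)) /\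
    exists eps : nat -> R,
      (eps n @[n --> \oo] --> (0 : R)) /\
      (forall n : nat, (0 < n)%N -> ~~ odd n ->
         (ordered_ramsey (M n))%:R = n%:R `^ (q + eps n)).
Proof.
(* The division by 4 leaves at least [n / 8] edges for the consecutive part once
   [n >= 8]; the successor keeps [k n] positive. *)
pose k n := (Num.truncn (n%:R `^ (q - 1) / 4)).+1.
have x_le n : (0 < n)%N -> (n%:R : R) `^ (q - 1) <= n%:R.
  by move=> n0; rewrite ler1_powR ?ler1n //; lra.
have le_k n : (0 < n)%N -> (4 * k n <= n + 4)%N.
  move=> n0; have := x_le n n0; have := powR_ge0 (n%:R : R) (q - 1).
  set x := _ `^ _ => x0 xn.
  have : ((Num.truncn (x / 4))%:R : R) <= x / 4 by rewrite truncn_le; lra.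
  rewrite /k -/x; move: (Num.truncn _) => m hm.
  suff : (4 * m <= n)%N by lia.
  by rewrite -(ler_nat R) natrM; lra.
exists (fun n => matching (k n) n); split.
  move=> n n0 en; apply: matching_is_ordered_matching => //.
  by have := le_k n n0; lia.
have [|||eps [eps0 epsE]] := @powR_asymptotics R q 32
    (fun n => (0 < n)%N && ~~ odd n) (fun n => ordered_ramsey (matching (k n) n)).
- by lra.
- move=> n /andP[n0 en]; apply/andP; split; first lia.
  apply: leq_ltn_trans (@lt_ordered_ramsey_matching (k n) 0 n _ _) => //.
  by have := le_k n n0; lia.
(* With [x = n^(q-1)], [x / 4 <= k <= 2 x] and [n / 8 <= t <= n / 2], so the
   bounds [k t] and [10 k t] are within a factor 32 of [x n = n^q]. *)
- exists 8%N => // n /= n8 /andP[n0 en].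
  have kn := le_k n n0; set t := (n./2 - k n)%N.
  have t_ge : (n <= 8 * t)%N by rewrite /t; lia.
  have t_le : (2 * t <= n)%N by rewrite /t; lia.
  have := x_le n n0; have := @mulr_powRB1 R n%:R q; rewrite ler0n.
  have x1 : 1 <= (n%:R : R) `^ (q - 1).
    by rewrite -[leLHS](powRr0 n%:R) ler_powR ?ler1n //; lra.
  have kE : k n = (Num.truncn (n%:R `^ (q - 1) / 4)).+1 by [].
  move: (k n) kn @t t_ge t_le kE => k' kn t t_ge t_le.
  set x := _ `^ _ in x1 * => k'E /(_ isT ltac:(lra)) <- xn.
  have k_ge : x <= 4 * k'%:R.
    by have := truncnS_gt (x / 4); rewrite -k'E; lra.
  have k_le : k'%:R <= 2 * x.
    have : ((Num.truncn (x / 4))%:R : R) <= x / 4 by rewrite truncn_le; lra.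
    by rewrite k'E -(natr1 (Num.truncn _)); lra.
  have lower : (k' * t <= ordered_ramsey (matching k' n))%N.
    have k0 : (0 < k')%N by rewrite k'E.
    have := @lt_ordered_ramsey_matching k' t n k0 ltac:(rewrite /t; lia).
    by nia.
  have upper : (ordered_ramsey (matching k' n) <= 10 * (k' * t))%N.
    have := @ordered_ramsey_matching_le k' t n ltac:(rewrite /t; lia).
    have k0 : (0 < k')%N by rewrite k'E.
    by nia.
  move: lower upper; rewrite -!(ler_nat R) !natrM.
  move: t_ge t_le; rewrite -!(ler_nat R) !natrM.
  move: (ordered_ramsey _) => r t_ge t_le lower upper.
  apply/andP; split; nra.
exists eps; split=> // n n0 en; apply: epsE.
by rewrite n0.
Qed.
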